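(* For any fixed constant $r$, the triangle enumeration problem can be solved in $O(n^{r-5/3}/\log n)$ rounds in the CLIQUE model for hypergraphs of rank $r$ on $n$ vertices.
   Context: A hypergraph $H=(V,E)$ has vertex set $V$, $|V|=n$, and a set $E$ of nonempty subsets of $V$; its rank is the maximum cardinality of an edge. A triangle is a simple cycle of length three $(v_0,e_0,v_1,e_1,v_2,e_2)$: $v_0,v_1,v_2\in V$ distinct, $e_0,e_1,e_2\in E$ distinct, and $v_i\in e_{i-1}\cap e_i$ (indices mod $3$). It is induced if moreover $v_i\notin e_{i+1}$ for each $i$. In the triangle enumeration problem each vertex $v$ outputs a set $\mathcal T_v$ of triangles such that the $\mathcal T_v$ are pairwise disjoint and $\bigcup_v\mathcal T_v$ is the set of all triangles of $H$; the result applies both to enumerating all triangles and to enumerating all induced triangles. CLIQUE model: vertices are computing nodes with unique $O(\log n)$-bit IDs; computation proceeds in synchronous rounds with unbounded local computation; in each round each vertex may send a distinct $B$-bit message, $B=\Theta(\log n)$, to every other vertex of $V$. Initially each vertex knows its own ID, and its incident edges, including the IDs of all vertices in them ($\mathrm{KT}_1$). *)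

(* Defs.v *)
From mathcomp Require Import all_boot all_order all_algebra.
Set Implicit Arguments.
Unset Strict Implicit.
Unset Printing Implicit Defensive.

Import GRing.Theory.

Record hypergraph (T : finType) := Hypergraph {
  vertices : {set T};
  edges : {set {set T}};
  edgesP : forall e, e \in edges -> e != set0 /\ e \subset vertices }.

Section Hypergraphs.
Variables (T : finType) (H : hypergraph T).

Definition rank : nat := \max_(e in edges H) #|e|.

Definition incident (v : T) : {set {set T}} := [set e in edges H | v \in e].

End Hypergraphs.

(* The sequence (v_0, e_0, v_1, e_1, v_2, e_2), stored as the pair (v, e) of
   its vertex and edge components.  Index arithmetic below takes place in the
   ring 'I_3, i.e. modulo 3. *)
Definition cycle3 (T : finType) : finType :=
  ({ffun 'I_3 -> T} * {ffun 'I_3 -> {set T}})%type.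

Section Triangles.
Variables (T : finType) (H : hypergraph T).

Definition is_triangle (t : cycle3 T) : bool :=
  let: (v, e) := t in
  [&& [forall i, v i \in vertices H], injectiveb v,
      [forall i, e i \in edges H], injectiveb e
    & [forall i, v i \in e (i - 1)%R :&: e i]].

Definition is_induced_triangle (t : cycle3 T) : bool :=
  is_triangle t && [forall i, t.1 i \notin t.2 (i + 1)%R].

Definition enumerates (P : pred (cycle3 T)) (O : T -> {set cycle3 T}) : Prop :=
  (forall u v, u \in vertices H -> v \in vertices H -> u != v ->
     [disjoint O u & O v]) /\
  \bigcup_(v in vertices H) O v = [set t | P t].

End Triangles.

(* Vertices are identified with their IDs: a network whose IDs have b bits is
   a hypergraph on a subset of [ID b]. *)
Definition ID (b : nat) : finType := b.-tuple bool.

(* What is put on one directed link in one round; [None] is silence. *)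
Definition message (B : nat) : Type := option (B.-tuple bool).

(* The code run by every node.  A node starts from its own ID and its incident
   edges only; in particular it does not know the set of all vertices.
   Messages are addressed by ID, and those addressed to an ID that is not
   a vertex are lost.  The state type and the functions are arbitrary, as local
   computation is unbounded. *)
Record clique_algorithm (b B : nat) := CliqueAlgorithm {
  state : Type;
  init : ID b -> {set {set ID b}} -> state;
  send : state -> ID b -> message B;
  receive : state -> (ID b -> message B) -> state;
  output : state -> {set cycle3 (ID b)} }.

Section Execution.
Variables (b B : nat) (A : clique_algorithm b B) (H : hypergraph (ID b)).

Definition initial (v : ID b) : state A := init A v (incident H v).

Definition round (c : ID b -> state A) (v : ID b) : state A :=
  receive (c v)
    (fun u => if (u \in vertices H) && (u != v) then send (c u) v else None).

Definition outputs (t : nat) (v : ID b) : {set cycle3 (ID b)} :=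
  output (iter t round initial v).

End Execution.

(* [t] rounds of the CLIQUE model with b-bit IDs and B-bit messages suffice to
   enumerate the [P]-triangles of every hypergraph of rank r on n vertices. *)
Definition clique_solvable (P : forall T : finType, hypergraph T -> pred (cycle3 T))
    (r n b B t : nat) : Prop :=
  exists A : clique_algorithm b B,
    forall H : hypergraph (ID b), #|vertices H| = n -> rank H = r ->
      enumerates H (P _ H) (outputs A H t).

(* Main.v *)
(* Let k be about the cube root of n and cut the vertices into k blocks of size
   O(k^2).  The k^3 <= n triples of blocks are assigned to different vertices,
   and a vertex outputs the triangles with v_0, v_1, v_2 in its blocks.  It needs
   to know the edges through x, y for x, y in two of its blocks, that is O(k^4)
   bitmaps of n^(r-2) bits each, one bit per candidate edge through x and y.
   Each bitmap travels over one relay; the relays are spread such that every link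
   carries O(k n^(r-2)) bits in both stages.  Who sends which bit is determined
   by the vertex set alone, which is learnt in one round. *)

Require Import Defs.
From mathcomp Require Import all_boot all_order all_algebra.
From mathcomp Require Import all_classical all_reals all_analysis.
From mathcomp Require Import zify ring lra.
Import Order.TTheory GRing.Theory Num.Theory.
Import numFieldNormedType.Exports.
Set Implicit Arguments.
Unset Strict Implicit.
Unset Printing Implicit Defensive.

(** * Information that nodes can acquire in a given number of rounds *)

Section Knowledge.
Variables (b B : nat).

(** What a node knows after [t] rounds, read off its state by [out]. The type [X] is free, whereas
    the field [output] yields only sets of triangles, so protocols can be built in stages. *)
Definition computes (t : nat) (X : Type) (F : hypergraph (ID b) -> ID b -> X) : Prop :=
  exists (A : clique_algorithm b B) (out : state A -> X),
    forall H v, v \in vertices H ->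
      out (iter t (Defs.round H) (initial A H) v) = F H v.

Lemma computes_initial : computes 0 (fun H v => (v, incident H v)).
Proof.
exists (@CliqueAlgorithm b B _ (fun v E => (v, E)) (fun _ _ => None)
  (fun s _ => s) (fun _ => finset.set0)).
by exists id.
Qed.

Lemma computes_map (t : nat) (X Y : Type) (F : hypergraph (ID b) -> ID b -> X)
    (G : hypergraph (ID b) -> ID b -> Y) (g : X -> Y) :
  (forall H v, v \in vertices H -> g (F H v) = G H v) ->
  computes t F -> computes t G.
Proof.
move=> gF [A [out AP]]; exists A, (g \o out) => H v vH /=.
by rewrite AP // gF.
Qed.

Lemma computes_round (t : nat) (X : Type) (F : hypergraph (ID b) -> ID b -> X)
    (m : X -> ID b -> message B) :
  computes t F ->
  computes t.+1 (fun H v => (F H v, fun u =>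
    if (u \in vertices H) && (u != v) then m (F H u) v else None)).
Proof.
move=> [A [out AP]].
(* The state counts rounds: [A] runs for [t] rounds and is then frozen, while one more round sends
   [m] and keeps what arrives. *)
pose A' := @CliqueAlgorithm b B (nat * state A * (ID b -> message B))
  (fun v E => (0, init A v E, fun=> None))
  (fun s u => if s.1.1 < t then send s.1.2 u else m (out s.1.2) u)
  (fun s g => (s.1.1.+1, if s.1.1 < t then receive s.1.2 g else s.1.2, g))
  (fun=> finset.set0).
exists A', (fun s => (out s.1.2, s.2)) => H v vH.
have run i u : i <= t -> (iter i (Defs.round H) (initial A' H) u).1 =
    (i, iter i (Defs.round H) (initial A H) u).
  elim: i u => [//|i IH] u it /=.
  rewrite IH ?(ltnW it) //= it; congr (_, _); congr receive.
  by apply/funext => w; rewrite IH ?(ltnW it) //= it.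
rewrite iterS {1}/Defs.round /= run //= ltnn AP //; congr (_, _).
apply/funext => u; case: ifP => // /andP[uH _].
by rewrite run //= ltnn AP.
Qed.

(** Every node breaks silence towards all IDs; the senders heard, with the receiver itself, are the
    vertices. This works even for [B = 0], as the empty message differs from silence. *)
Lemma computes_vertices : computes 1 (fun H v => (v, vertices H, incident H v)).
Proof.
have := computes_round (fun _ _ => Some [tuple of nseq B true]) computes_initial.
apply: (computes_map (g := fun s =>
  (s.1.1, s.1.1 |: [set u | s.2 u != None]%SET, s.1.2))) => H v vH /=.
congr (_, _, _); apply/setP => u; rewrite !inE.
by case: eqVneq => [->|_] //; rewrite andbT; case: ifP.
Qed.

(* A round carries [maxn B 1] bits on each link: for [B = 0], silence is a 0
   and the empty message a 1. *)
Definition encode_bits (f : nat -> bool) : message B :=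
  if (B == 0) && ~~ f 0 then None else Some [tuple f i | i < B].

Definition decode_bits (msg : message B) (i : nat) : bool :=
  if msg is Some s then nth true s i else false.

Lemma encode_bitsK (f : nat -> bool) (i : nat) :
  i < maxn B 1 -> decode_bits (encode_bits f) i = f i.
Proof.
rewrite /encode_bits; case: (posnP B) => [B0|B0].
  have -> : maxn B 1 = 1 by rewrite B0.
  rewrite ltnS leqn0 => /eqP ->; case: (f 0) => //=.
  by rewrite nth_default // size_map size_enum_ord B0.
rewrite (maxn_idPl B0) => iB /=.
by rewrite (nth_map (Ordinal iB)) ?size_enum_ord // nth_enum_ord.
Qed.

Lemma computes_bits (t d : nat) (X : Type) (F : hypergraph (ID b) -> ID b -> X)
    (m : X -> ID b -> nat -> bool) :
  computes t F ->
  computes (t + d) (fun H v => (F H v, fun u j =>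
    [&& u \in vertices H, u != v, j < d * maxn B 1 & m (F H u) v j])).
Proof.
set w := maxn B 1 => cF; elim: d => [|d IH].
  rewrite addn0; apply: (computes_map (g := fun x => (x, fun _ _ => false))) cF.
  move=> H v vH; congr (_, _).
  by apply/funext => u; apply/funext => j; rewrite !andbF.
rewrite addnS.
have := computes_round (fun s u => encode_bits (fun i => m s.1 u (d * w + i))) IH.
apply: (computes_map (g := fun s => (s.1.1, fun u j =>
  if j < d * w then s.1.2 u j else (j < d.+1 * w) && decode_bits (s.2 u) (j - d * w)))).
move=> H v vH /=; congr (_, _).
apply/funext => u; apply/funext => j.
have [jd|jd] := ltnP j (d * w).
  by rewrite (leq_trans jd) // leq_mul2r leqnSn orbT.
have [jd1|//] := ltnP j (d.+1 * w); last by rewrite !andbF.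
case: ifP => [/andP[-> ->] | /negbT]; last first.
  by rewrite negb_and => /orP[] /negPf-> //=; rewrite andbF.
rewrite encode_bitsK ?subnKC //=.
by move: jd1; rewrite mulSn addnC; rewrite -/w; lia.
Qed.

(* Two nodes that know the vertex set agree on the list [q V u v] without any
   communication, so membership of its entries in a set costs one bit each. *)
Lemma computes_share (t d : nat) (S : hypergraph (ID b) -> ID b -> {set {set ID b}})
    (q : {set ID b} -> ID b -> ID b -> seq {set ID b}) :
  computes t (fun H v => (v, vertices H, S H v)) ->
  computes (t + d) (fun H v => (v, vertices H,
    \bigcup_(u in vertices H)
      [set e in S H u | e \in take (d * maxn B 1) (q (vertices H) u v)]%SET)).
Proof.
set w := maxn B 1.
move/(computes_bits d (fun (s : ID b * {set ID b} * {set {set ID b}}) v j =>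
  nth finset.set0 (q s.1.2 s.1.1 v) j \in s.2)).
(* A node sends nothing to itself, so its own edges are looked up directly. Lists may repeat [e];
   the bit read is that of its first occurrence, which lies in the prefix taken. *)
apply: (computes_map (g := fun s : ID b * {set ID b} * {set {set ID b}} * (ID b -> nat -> bool) =>
  let: (v, V, E, msg) := s in (v, V,
  \bigcup_(u in V) [set e in take (d * w) (q V u v) |
    if u == v then e \in E else msg u (index e (q V u v))]%SET))).
move=> H v vH; congr (_, _, _); apply: eq_bigr => u uH; apply/setP => e.
rewrite !inE andbC; case: (boolP (e \in take _ _)) => [ein|_]; last by rewrite !andbF.
rewrite !andbT; case: eqVneq => [-> //|uv] /=.
rewrite uH /= nth_index ?(mem_take ein) //.
by rewrite index_ltn.
Qed.

End Knowledge.

(** * Candidate edges through two vertices *)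

Section Candidates.
Variables (T : finType) (s : seq T) (x y : T).

(** Vertices may repeat, which covers edges with fewer than [m.+2] vertices and keeps the length
    exactly [size s ^ m]. *)
Fixpoint candidates (m : nat) : seq {set T} :=
  if m is m'.+1 then [seq z |: e | z <- s, e <- candidates m']%SET
  else [:: [set x; y]%SET].

Lemma size_candidates (m : nat) : size (candidates m) = size s ^ m.
Proof. by elim: m => //= m IH; rewrite size_allpairs IH expnS. Qed.

Lemma mem_candidates (m : nat) (e : {set T}) :
  x != y -> x \in e -> y \in e -> {subset e <= s} -> #|e| <= m.+2 ->
  e \in candidates m.
Proof.
move=> xy; elim: m e => [|m IH] e xe ye es em.
  have sub : ([set x; y] \subset e)%SET by rewrite finset.subUset !finset.sub1set xe.
  by rewrite mem_seq1 eq_sym eqEcard sub cards2 xy.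
apply/allpairsP.
have [e2|] := eqVneq (e :\: [set x; y])%SET finset.set0; last first.
  move=> /finset.set0Pn[z]; rewrite !inE negb_or -andbA => /and3P[zx zy ze].
  exists (z, e :\ z)%SET => /=; split; [exact: es| |by rewrite finset.setD1K].
  apply: IH; rewrite ?inE ?xe ?ye ?(eq_sym x) ?(eq_sym y) ?zx ?zy //.
    by move=> u; rewrite !inE => /andP[_ /es].
  by move: em; rewrite (cardsD1 z) ze.
(* Here [e] is [[set x; y]]: the spare slot is filled by adding [x] again. *)
exists (x, e) => /=; split; [exact: es| |]; last first.
  by apply/esym/finset.setUidPr; rewrite finset.sub1set.
apply: IH => //; apply: leq_trans (_ : 2 <= _) => //.
rewrite -[2]/(true.+1) -xy -cards2; apply: subset_leq_card.
by rewrite -finset.setD_eq0 e2.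
Qed.

End Candidates.

Lemma size_flatten_const (I : Type) (T : Type) (f : I -> seq T) (s : seq I) (c : nat) :
  (forall i, size (f i) = c) -> size (flatten [seq f i | i <- s]) = size s * c.
Proof. by move=> fc; elim: s => //= i s IH; rewrite size_cat fc IH. Qed.

(** * Base-k digits of vertex indices *)

Section Digits.
Variable k : nat.

(** [a2] may exceed [k]; it then carries the two leading digits as x_2 + k x_3. *)
Definition position (a0 a1 a2 : nat) : nat := (a2 * k + a1) * k + a0.

Definition digits (i : nat) : nat * nat * nat :=
  (i %% k, (i %/ k) %% k, (i %/ k %/ k) %% k).

Lemma positionK (a0 a1 a2 : nat) :
  a0 < k -> a1 < k -> a2 < k -> digits (position a0 a1 a2) = (a0, a1, a2).
Proof.
move=> h0 h1 h2; have k0 : 0 < k by exact: leq_ltn_trans h0.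
rewrite /digits /position !divnMDl // !(divn_small h0) addn0 modnMDl.
by rewrite divnMDl // (divn_small h1) addn0 modnMDl !modn_small.
Qed.

Lemma position_lt (a0 a1 a2 : nat) :
  a0 < k -> a1 < k -> a2 < k -> position a0 a1 a2 < k ^ 3.
Proof.
rewrite /position !expnS expn0 muln1 => h0 h1 h2.
have : a2.+1 * k <= k * k by rewrite leq_mul2r h2 orbT.
move=> h; have : (a2 * k + a1).+1 * k <= k * k * k.
  by rewrite leq_mul2r; apply/orP; right; lia.
lia.
Qed.

End Digits.

(** * Routing through relays *)

Section Protocol.
Variables (b k m : nat).
Implicit Types (V : {set ID b}).

Definition rank_in V (v : ID b) : nat := index v (enum V).

(* Cut the index of [x] in base [k] as (x_0, x_1, x_2, x_3), least significant
   digit first, where x_3 < 8.  The block of [x] is x_0.  The candidate edges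
   through [x], [y] travel from [x] to the node with index (x_1, y_1, y_2), and
   from there to the nodes whose index contains the digits x_0, y_0 cyclically
   next to each other.  This leaves O(k) pairs [x], [y] on every link. *)
Definition to_relay V (x w : ID b) : seq {set ID b} :=
  let: (_, w1, w2) := digits k (rank_in V w) in
  flatten [seq flatten [seq
    candidates (enum V) x (nth x (enum V) (position k a w1 (h * k + w2))) m
  | h <- iota 0 8] | a <- iota 0 k].

(** The relay [u] fixes x_1, y_1, y_2 and the pair [p] fixes the blocks x_0, y_0; [c] stands for x_2
    + k x_3 and [h] for y_3. Out-of-range positions default to [u], which only adds candidates to
    test. *)
Definition from_relay V (u w : ID b) : seq {set ID b} :=
  let: (u0, u1, u2) := digits k (rank_in V u) in
  let: (w0, w1, w2) := digits k (rank_in V w) in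
  flatten [seq flatten [seq flatten [seq
    candidates (enum V) (nth u (enum V) (position k p.1 u0 c))
      (nth u (enum V) (position k p.2 u1 (h * k + u2))) m
  | h <- iota 0 8] | c <- iota 0 (8 * k)]
  | p <- [:: (w0, w1); (w1, w2); (w2, w0)]].

Lemma size_to_relay V x w : size (to_relay V x w) = k * (8 * #|V| ^ m).
Proof.
rewrite /to_relay; case: digits => [[_ w1] w2].
rewrite -[in RHS](size_iota 0 k); apply: size_flatten_const => a.
rewrite -[in RHS](size_iota 0 8); apply: size_flatten_const => h.
by rewrite size_candidates -cardE.
Qed.

Lemma size_from_relay V u w :
  size (from_relay V u w) = 3 * (8 * k * (8 * #|V| ^ m)).
Proof.
rewrite /from_relay; case: digits => [[u0 u1] u2]; case: digits => [[w0 w1] w2].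
apply: size_flatten_const => p.
rewrite -[in RHS](size_iota 0 (8 * k)); apply: size_flatten_const => c.
rewrite -[in RHS](size_iota 0 8); apply: size_flatten_const => h.
by rewrite size_candidates -cardE.
Qed.

Section Delivery.
Variables (V : {set ID b}) (e : {set ID b}).
Hypotheses (k_lo : k ^ 3 <= #|V|) (k_hi : #|V| < 8 * k ^ 3).
Hypotheses (eV : e \subset V) (em : #|e| <= m.+2).

Lemma k_gt0 : 0 < k.
Proof. by move: k_hi; rewrite expnS; case: k. Qed.

Lemma rank_in_lt x : x \in V -> rank_in V x < #|V|.
Proof. by move=> xV; rewrite cardE index_mem mem_enum. Qed.

(** By [k_lo] every triple of digits below [k] is the index of a vertex, so all relays and receivers
    exist. *)
Lemma rank_inK d a0 a1 a2 : a0 < k -> a1 < k -> a2 < k ->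
  let w := nth d (enum V) (position k a0 a1 a2) in
  w \in V /\ digits k (rank_in V w) = (a0, a1, a2).
Proof.
move=> h0 h1 h2 w.
have lt : position k a0 a1 a2 < size (enum V).
  by rewrite -cardE (leq_trans (position_lt h0 h1 h2)).
split; first by rewrite -mem_enum mem_nth.
by rewrite /rank_in index_uniq ?enum_uniq // positionK.
Qed.

Lemma nth_rank_in d x : x \in V -> nth d (enum V)
  (position k (rank_in V x %% k) (rank_in V x %/ k %% k) (rank_in V x %/ k %/ k)) = x.
Proof.
by move=> xV; rewrite /position -!divn_eq nth_index // mem_enum.
Qed.

Lemma mem_to_from_relay x y w w0 w1 w2 :
  x \in e -> y \in e -> x != y -> digits k (rank_in V w) = (w0, w1, w2) ->
  (rank_in V x %% k, rank_in V y %% k) \in [:: (w0, w1); (w1, w2); (w2, w0)] ->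
  exists u, [/\ u \in V, e \in to_relay V x u & e \in from_relay V u w].
Proof.
move=> xe ye xy wE pin.
have xV : x \in V by exact: (fintype.subsetP eV).
have yV : y \in V by exact: (fintype.subsetP eV).
have esub : {subset e <= enum V} by move=> z ze; rewrite mem_enum (fintype.subsetP eV).
have eC := mem_candidates xy xe ye esub em.
(* The leading digit is below 8 by [k_hi]. *)
have h8 i : i < #|V| -> i %/ k %/ k %/ k \in iota 0 8.
  move=> iV; rewrite mem_iota -!divnMA ltn_divLR ?muln_gt0 ?k_gt0 //.
  by rewrite (leq_trans iV) // ltnW // (leq_trans k_hi) // !expnS expn0 muln1 mulnA.
set i := rank_in V x in pin; set j := rank_in V y in pin.
have [uV uE] := @rank_inK x (i %/ k %% k) (j %/ k %% k) (j %/ k %/ k %% k)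
   (ltn_pmod _ k_gt0) (ltn_pmod _ k_gt0) (ltn_pmod _ k_gt0).
set u := nth _ _ _ in uV uE; exists u; split=> //.
  rewrite /to_relay uE; cbv iota beta; apply/flatten_mapP; exists (j %% k).
    by rewrite mem_iota ltn_mod k_gt0.
  apply/flatten_mapP; exists (j %/ k %/ k %/ k); first by rewrite h8 ?rank_in_lt.
  by rewrite -divn_eq nth_rank_in.
rewrite /from_relay uE wE; cbv iota beta; apply/flatten_mapP; exists (i %% k, j %% k) => //.
apply/flatten_mapP; exists (i %/ k %/ k).
  rewrite mem_iota add0n [0 <= _]/= -divnMA ltn_divLR ?muln_gt0 ?k_gt0 //.
  rewrite (leq_trans (rank_in_lt xV)) // ltnW // (leq_trans k_hi) //.
  by rewrite !expnS expn0 muln1 !mulnA.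
apply/flatten_mapP; exists (j %/ k %/ k %/ k); first by rewrite h8 ?rank_in_lt.
by rewrite -divn_eq !nth_rank_in.
Qed.

End Delivery.
End Protocol.

(** * Partial hypergraphs and locality of triangles *)

Section Subhypergraph.
Variables (T : finType) (V : {set T}) (S : {set {set T}}).

Lemma subhypergraph_subproof (e : {set T}) :
  e \in [set f in S | (f != finset.set0) && (f \subset V)]%SET ->
  e != finset.set0 /\ e \subset V.
Proof. by rewrite inE => /andP[_ /andP[]]. Qed.

Definition subhypergraph : hypergraph T := Hypergraph subhypergraph_subproof.

End Subhypergraph.

(* Deciding whether a sequence is a P-triangle only takes its own edges, so
   it can be done in the partial hypergraph received by a node. *)
Definition local_triangle_property
    (P : forall T : finType, hypergraph T -> pred (cycle3 T)) : Prop :=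
  forall (T : finType) (H H' : hypergraph T) (t : cycle3 T),
    vertices H' = vertices H -> {subset edges H' <= edges H} ->
    (P T H t -> is_triangle H t) /\
    P T H' t = P T H t && [forall i, t.2 i \in edges H'].

Lemma local_is_triangle : local_triangle_property is_triangle.
Proof.
move=> T H H' [v e] VE sub; split=> //=.
rewrite /is_triangle VE.
case: (boolP [forall i, e i \in edges H']) => [/forallP eH'|_]; last by rewrite !andbF.
rewrite andbT; suff -> : [forall i, e i \in edges H] by [].
by apply/forallP => i; exact: sub.
Qed.

Lemma local_is_induced_triangle : local_triangle_property is_induced_triangle.
Proof.
move=> T H H' t VE sub; split; first by case/andP.
by rewrite /is_induced_triangle (local_is_triangle t VE sub).2 andbAC.
Qed.

Lemma triangleP (T : finType) (H : hypergraph T) (t : cycle3 T) (i : 'I_3) :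
  is_triangle H t ->
  [/\ t.1 i \in vertices H, t.2 i \in edges H, t.1 i \in t.2 i,
      t.1 (i + 1)%R \in t.2 i & t.1 i != t.1 (i + 1)%R].
Proof.
case: t => v e /= /and5P[/forallP vV /injectiveP vi /forallP eE _ /forallP ve].
have := ve i; have := ve (i + 1)%R; rewrite !inE addrK => /andP[-> _] /andP[_ ->].
split=> //; apply/eqP => /vi /eqP; rewrite -subr_eq0 opprD addrA subrr sub0r oppr_eq0.
by rewrite oner_eq0.
Qed.

(** * From acquired information to enumeration *)

Lemma computes_solvable (P : forall T : finType, hypergraph T -> pred (cycle3 T))
    (r n b B t : nat) (O : hypergraph (ID b) -> ID b -> {set cycle3 (ID b)}) :
  computes B t O ->
  (forall H, #|vertices H| = n -> Defs.rank H = r -> enumerates H (P _ H) (O H)) ->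
  clique_solvable P r n b B t.
Proof.
move=> [A [out AP]] OP.
exists (@CliqueAlgorithm b B (state A) (@init _ _ A) (@send _ _ A) (@receive _ _ A) out).
move=> H Hn Hr; have [dis cov] := OP H Hn Hr.
have outE v : v \in vertices H ->
    outputs (@CliqueAlgorithm b B (state A) (@init _ _ A) (@send _ _ A) (@receive _ _ A) out)
      H t v = O H v by exact: AP.
split; first by move=> u v uH vH uv; rewrite !outE //; exact: dis.
by rewrite -cov; apply: eq_bigr => v vH; rewrite outE.
Qed.

Lemma clique_solvable_local (P : forall T : finType, hypergraph T -> pred (cycle3 T))
    (r n b B k m d1 d2 : nat) :
  local_triangle_property P -> r <= m.+2 ->
  k ^ 3 <= n -> n < k.+1 ^ 3 ->
  k * (8 * n ^ m) <= d1 * maxn B 1 ->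
  3 * (8 * k * (8 * n ^ m)) <= d2 * maxn B 1 ->
  clique_solvable P r n b B (1 + d1 + d2).
Proof.
(* The factor 8 comes from [k.+1 <= 2 * k], which needs [k > 0]; [n = 0] would force [k = 0]. *)
move=> locP rm k_lo k_hi0 hd1 hd2.
have k_hi : n > 0 -> n < 8 * k ^ 3.
  move=> n0; apply: (leq_trans k_hi0); rewrite -[8]/(2 ^ 3) -expnMn leq_exp2r //.
  have : 0 < k by move: k_hi0 n0; case: (k) => //; case: (n).
  lia.
(* The index of the node responsible for [t] packs the blocks of its three vertices. Distinct nodes
   have distinct indices, so no triangle is output twice. *)
pose dest V (t : cycle3 (ID b)) := position k (rank_in V (t.1 0%R) %% k)
  (rank_in V (t.1 1%R) %% k) (rank_in V (t.1 (1 + 1)%R) %% k).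
pose out V (v : ID b) S :=
  [set t | P _ (subhypergraph V S) t & rank_in V v == dest V t]%SET.
(* [S1] is what a node knows as a relay after the first stage, [S2] what it knows as a receiver
   after the second. *)
pose S1 (H : hypergraph (ID b)) v : {set {set ID b}} := \bigcup_(u in vertices H)
  [set e in incident H u | e \in take (d1 * maxn B 1) (to_relay k m (vertices H) u v)]%SET.
pose S2 (H : hypergraph (ID b)) v : {set {set ID b}} := \bigcup_(u in vertices H)
  [set e in S1 H u | e \in take (d2 * maxn B 1) (from_relay k m (vertices H) u v)]%SET.
have cS2 : computes B (1 + d1 + d2) (fun H v => (v, vertices H, S2 H v)).
  by apply: computes_share; apply: computes_share; exact: computes_vertices.
apply: (@computes_solvable _ _ _ _ _ _ (fun H v => out (vertices H) v (S2 H v))).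
  by apply: (computes_map (g := fun s => out s.1.2 s.1.1 s.2)) cS2.
move=> H Hn Hr; set V := vertices H in cS2 *.
have S2E v : {subset S2 H v <= edges H}.
  move=> e /bigcupP[u _]; rewrite inE => /andP[/bigcupP[u' _]].
  by rewrite !inE => /andP[/andP[]].
have local v t : v \in V -> P _ (subhypergraph V (S2 H v)) t =
    P _ H t && [forall i, t.2 i \in edges (subhypergraph V (S2 H v))].
  move=> vV; apply: (locP _ H _ t _ _).2 => //.
  by move=> e; rewrite inE => /andP[/S2E].
split.
  move=> u v uV vV uv; apply/pred0P => t /=; rewrite !inE.
  apply/negP => /andP[/andP[_ /eqP uE] /andP[_ /eqP vE]].
  case/eqP: uv; have := congr1 (nth u (enum V)) (etrans uE (esym vE)).
  by rewrite !nth_index // mem_enum.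
apply/setP => t; rewrite [RHS]inE; apply/bigcupP/idP => [[w wV]|Pt].
  by rewrite inE local // => /andP[/andP[]].
have tri : is_triangle H t by apply: (locP _ H H t _ _).1.
have V0 : n > 0.
  have [tV _ _ _ _] := triangleP 0%R tri.
  by rewrite -Hn; apply/card_gt0P; exists (t.1 0%R).
have {}k_hi : #|V| < 8 * k ^ 3 by rewrite Hn k_hi.
have k_lo' : k ^ 3 <= #|V| by rewrite Hn.
have k0 := k_gt0 k_hi.
have [wV wE] := @rank_inK b k V k_lo' (t.1 0%R) _ _ _ (ltn_pmod (rank_in V (t.1 0%R)) k0)
   (ltn_pmod (rank_in V (t.1 1%R)) k0) (ltn_pmod (rank_in V (t.1 (1 + 1)%R)) k0).
set w := nth _ _ _ in wV wE; exists w => //.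
rewrite inE local // Pt /=; apply/andP; split; last first.
  apply/eqP; rewrite /rank_in index_uniq ?enum_uniq // -cardE.
  by apply: leq_trans k_lo'; rewrite position_lt ?ltn_mod.
apply/forallP => i.
have [xV eE xe ye xy] := triangleP i tri.
have [e0 eV] := edgesP eE.
have em : #|t.2 i| <= m.+2.
  by apply: leq_trans rm; rewrite -Hr /Defs.rank; exact: leq_bigmax_cond.
(* The edge [t.2 i] joins the blocks of [t.1 i] and [t.1 (i + 1)], which are cyclically adjacent
   digits of [w]. *)
have [|u [uV up down]] := mem_to_from_relay k_lo' k_hi eV em xe ye xy wE.
  case: i {eE xe ye xy xV e0 eV em} => [[|[|[|//]]] i3].
  - by rewrite (_ : Ordinal i3 = 0%R) ?add0r ?mem_head //; exact: val_inj.
  - by rewrite (_ : Ordinal i3 = 1%R) ?inE ?eqxx ?orbT //; exact: val_inj.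
  - rewrite (_ : Ordinal i3 = (1 + 1)%R); last exact: val_inj.
    by rewrite (_ : (1 + 1 + 1 = 0 :> 'I_3)%R) ?inE ?eqxx ?orbT //; exact: val_inj.
rewrite inE e0 eV /= andbT; apply/bigcupP; exists u => //.
(* By [hd2], and below by [hd1], the transmitted prefix is the whole list. *)
rewrite inE take_oversize ?down ?andbT; last by rewrite size_from_relay Hn.
apply/bigcupP; exists (t.1 i) => //.
by rewrite !inE eE xe take_oversize // size_to_relay Hn.
Qed.

(** A triangle edge has two distinct vertices, so there are no triangles. This case stands apart
    because r - 5/3 is negative: the bound tends to 0 and forces zero rounds for large n. *)
Lemma clique_solvable_rank_lt2 (P : forall T : finType, hypergraph T -> pred (cycle3 T))
    (r n b B : nat) :
  local_triangle_property P -> r < 2 -> clique_solvable P r n b B 0.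
Proof.
move=> locP r2.
have c0 : computes B 0
    (fun (H : hypergraph (ID b)) v => (finset.set0 : {set cycle3 (ID b)})).
  exact: (computes_map (g := fun=> finset.set0)) (computes_initial b B).
apply: (computes_solvable c0) => H _ Hr; split.
  by move=> u v _ _ _; apply/pred0P => t; rewrite /= !inE.
apply/setP => t; rewrite big1 // !inE; apply/esym/negP => Pt.
have [_ eE xe ye xy] := triangleP ord0 ((locP _ H H t erefl (fun _ => id)).1 Pt).
suff : 2 <= r by rewrite leqNgt r2.
rewrite -Hr /Defs.rank; apply: (@leq_trans #|t.2 ord0|); last exact: leq_bigmax_cond.
by apply/card_gt1P; exists (t.1 ord0), (t.1 (ord0 + 1)%R).
Qed.

(** * Integer cube roots and the number of rounds *)

Lemma cubic_root_exists (n : nat) : {k | k ^ 3 <= n < k.+1 ^ 3}.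
Proof.
elim: n => [|n [k /andP[kn nk]]]; first by exists 0.
have [le|lt] := leqP (k.+1 ^ 3) n.+1.
  exists k.+1; rewrite le (leq_ltn_trans nk) // ltn_exp2r //.
by exists k; rewrite lt leqW.
Qed.

Definition cubic_root (n : nat) : nat := sval (cubic_root_exists n).

Lemma cubic_root_le (n : nat) : cubic_root n ^ 3 <= n.
Proof. by rewrite /cubic_root; case: cubic_root_exists => k /= /andP[]. Qed.

Lemma lt_cubic_root (n : nat) : n < (cubic_root n).+1 ^ 3.
Proof. by rewrite /cubic_root; case: cubic_root_exists => k /= /andP[]. Qed.

Definition rounds (B N : nat) : nat := (N %/ maxn B 1).+1.

Lemma leq_rounds (B N : nat) : N <= rounds B N * maxn B 1.
Proof. by rewrite ltnW // ltn_ceil // leq_max orbT. Qed.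

Definition round_count (m n B : nat) : nat :=
  1 + rounds B (cubic_root n * (8 * n ^ m))
  + rounds B (3 * (8 * cubic_root n * (8 * n ^ m))).

Lemma clique_solvable_round_count (P : forall T : finType, hypergraph T -> pred (cycle3 T))
    (r n b B : nat) : local_triangle_property P ->
  clique_solvable P r n b B (round_count (r - 2) n B).
Proof.
move=> locP; rewrite /round_count.
apply: (clique_solvable_local _ locP (k := cubic_root n) (m := r - 2));
  rewrite ?leq_rounds ?cubic_root_le ?lt_cubic_root //.
lia.
Qed.

(** * Asymptotic estimate of the round count *)

Section Asymptotics.
Local Open Scope ring_scope.
Variable R : realType.

Lemma natr_rounds (B N : nat) : (0 < B)%N -> (rounds B N)%:R <= N%:R / B%:R + 1 :> R.
Proof.
move=> B0; rewrite /rounds (maxn_idPl B0) -natr1 lerD2r ler_pdivlMr ?ltr0n //.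
by rewrite -natrM ler_nat leq_trunc_div.
Qed.

Lemma cubic_root_powR (n : nat) : (cubic_root n)%:R <= (n%:R : R) `^ 3^-1.
Proof.
have -> : (cubic_root n)%:R = ((cubic_root n)%:R ^+ 3 : R) `^ 3^-1.
  by rewrite -powR_mulrn // -powRrM mulfV ?powRr1 // pnatr_eq0.
by rewrite ge0_ler_powR ?invr_ge0 ?nnegrE ?exprn_ge0 // -natrX ler_nat cubic_root_le.
Qed.

(** The bound of ln y by y, taken at y = x^(1/3). It serves to absorb additive constants into the
    main term. *)
Lemma ln_le_powR (x : R) : 0 < x -> ln x <= 3 * x `^ 3^-1.
Proof.
move=> x0; have := ln_sublinear (powR_gt0 3^-1 x0); rewrite ln_powR => h.
by lra.
Qed.

Lemma round_count_bound (m n B : nat) (c : R) :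
  0 < c -> (1 < n)%N -> ln n%:R <= c * B%:R ->
  (round_count m n B)%:R <=
    (9 + 200 * c) * ((n%:R : R) `^ (m%:R + 3^-1) / ln n%:R).
Proof.
move=> c0 n1 cB; have l0 : 0 < ln (n%:R : R) by rewrite ln_gt0 // ltr1n.
have n0 : 0 < (n%:R : R) by rewrite ltr0n ltnW.
have BR0 : 0 < (B%:R : R) by rewrite -(pmulr_rgt0 _ c0) (lt_le_trans l0).
have B0 : (0 < B)%N by rewrite -(ltr0n R).
set Q := _ `^ _.
have QE : Q = n%:R ^+ m * n%:R `^ 3^-1.
  by rewrite /Q powRD ?powR_mulrn ?ltW // (gt_eqF n0) implybT.
have kQ : (cubic_root n * n ^ m)%:R <= Q.
  by rewrite QE mulrC natrM natrX ler_wpM2r ?exprn_ge0 ?cubic_root_powR.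
have Q0 : 0 < Q by rewrite powR_gt0.
have lQ : ln (n%:R : R) <= 3 * Q.
  apply: le_trans (ln_le_powR n0) _; rewrite ler_pM2l // QE ler_peMl ?powR_ge0 //.
  by rewrite exprn_ege1 // ler1n ltnW.
have r1 := natr_rounds (cubic_root n * (8 * n ^ m)) B0.
have r2 := natr_rounds (3 * (8 * cubic_root n * (8 * n ^ m))) B0.
rewrite /round_count !natrD.
(* 3 counts the opening round and one rounding per stage; 200 = 8 + 3 * 8 * 8. *)
apply: (@le_trans _ _ (3 + 200 * Q / B%:R)).
  suff : (cubic_root n * (8 * n ^ m))%:R / B%:R +
      (3 * (8 * cubic_root n * (8 * n ^ m)))%:R / B%:R <= 200 * Q / B%:R :> R by lra.
  rewrite -mulrDl ler_pM2r ?invr_gt0 // -natrD.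
  have -> : (cubic_root n * (8 * n ^ m) + 3 * (8 * cubic_root n * (8 * n ^ m))
      = 200 * (cubic_root n * n ^ m))%N by ring.
  by rewrite natrM ler_pM2l.
(* 9 Q / ln n absorbs the 3, as ln n <= 3 Q; the other term uses ln n <= c B. *)
rewrite (mulrDl 9) lerD //.
  by rewrite mulrA ler_pdivlMr //; lra.
by rewrite mulrACA ler_pM2l ?mulr_gt0 // ler_pdivlMr // mulrC ler_pdivrMr.
Qed.

End Asymptotics.

Local Open Scope classical_set_scope.
Local Open Scope ring_scope.

Theorem theorem10 (R : realType) (r : nat) (b B : nat -> nat)
    (hb : (fun n => (b n)%:R : R) =O_\oo (fun n => ln (n%:R : R)))
    (hB : (fun n => (B n)%:R : R) =Theta_\oo (fun n => ln (n%:R : R))) :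
  exists T : nat -> nat,
    (fun n => (T n)%:R : R) =O_\oo
      (fun n => (n%:R : R) `^ (r%:R - 5%:R / 3%:R) / ln (n%:R : R)) /\
    forall n : nat,
      clique_solvable (@is_triangle) r n (b n) (B n) (T n) /\
      clique_solvable (@is_induced_triangle) r n (b n) (B n) (T n).
Proof.
have [r2|r2] := ltnP r 2.
  exists (fun=> 0%N); split.
    by apply/eqO_exP; exists 1 => //; near=> n; rewrite normr0 mul1r.
  move=> n; split; apply: clique_solvable_rank_lt2 => //.
    exact: local_is_triangle.
  exact: local_is_induced_triangle.
exists (fun n => round_count (r - 2) n (B n)); split; last first.
  move=> n; split; apply: clique_solvable_round_count.
    exact: local_is_triangle.
  exact: local_is_induced_triangle.
(* The lower half of Theta: messages have at least ln n / c bits for large n. *)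
have [c c0 cB] : exists2 c, 0 < c &
    \forall n \near \oo, `|ln (n%:R : R)| <= c * `|(B n)%:R|.
  by move: hB; rewrite eqThetaE bigThetaE eqOmegaO => -[_ /eqO_exP].
apply/eqO_exP; exists (9 + 200 * c); first by rewrite addr_gt0 // mulr_gt0.
near=> n.
have n1 : (1 < n)%N by near: n; exact: nbhs_infty_gt.
have l0 : 0 < ln (n%:R : R) by rewrite ln_gt0 // ltr1n.
rewrite !ger0_norm ?divr_ge0 ?powR_ge0 ?(ltW l0) //.
(* Bitmaps of n^(r-2) bits, about n^(1/3) of them per link. *)
have -> : r%:R - 5 / 3 = (r - 2)%N%:R + 3^-1 :> R by rewrite natrB //; field.
apply: round_count_bound => //.
have : `|ln (n%:R : R)| <= c * `|(B n)%:R| by near: n.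
by rewrite !ger0_norm // ltW.
Unshelve. all: by end_near.
Qed.
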